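(* Consider the many-body integrator $$\bm q_{A\,n+1}-\bm q_{A\,n}=\Delta t_n\sum_{B=1}^N m^{-1}_{AB}\,\bm p^B_{n+\frac12},\qquad \bm p^A_{n+1}-\bm p^A_n=-\sum_{B\ne A}\bm f^{AB}_{\square},\qquad A=1,\dots,N,$$ where the algorithmic force $\bm f^{AB}_\square$ is any one of $\bm f^{AB}_{\mathrm{mp}}$ (mid-point), $\bm f^{AB}_{\mathrm{lg}}$ (LaBudde-Greenspan), $\bm f^{AB}_{\mathrm{ge}}$ (generalized Eyre), $\bm f^{AB}_{\mathrm{pm}}$ (perturbed mid-point), $\bm f^{AB}_{\mathrm{pt}}$ (perturbed trapezoidal) defined in the context. Then each of these five integrators conserves the angular momentum: every solution $(\bm q_{n+1},\bm p_{n+1})$ of the step from $(\bm q_n,\bm p_n)$ satisfies $$\bm J(\bm q_{n+1},\bm p_{n+1})=\bm J(\bm q_n,\bm p_n),\qquad \bm J(\bm q,\bm p):=\sum_{A=1}^N\bm q_A\times\bm p^A.$$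
   Context: There are $N$ particles with positions $\bm q_A\in\mathbb R^3$ and momenta $\bm p^A\in\mathbb R^3$; $\bm q=(\bm q_1,\dots,\bm q_N)$, $\bm p=(\bm p^1,\dots,\bm p^N)$. The mass matrix $(m^{AB})_{A,B=1}^N$ is a constant real symmetric positive definite matrix and $m^{-1}_{AB}$ are the entries of its inverse. $\Delta t_n>0$. Pair potentials $\hat V_{AB}:(0,\infty)\to\mathbb R$ for $A\neq B$ satisfy $\hat V_{AB}=\hat V_{BA}$, and are split, symmetrically in $A,B$, as $\hat V_{AB}=\hat V_{AB\,\mathrm c}+\hat V_{AB\,\mathrm e}$ (twice differentiable, $\hat V_{AB\,\mathrm c}''\ge0$, $\hat V_{AB\,\mathrm e}''\le0$) and as $\hat V_{AB}=\hat V_{AB+}+\hat V_{AB-}$ (four times differentiable, $\hat V_{AB+}^{(4)}\ge0$, $\hat V_{AB-}^{(4)}\le0$). Notation: $\bm q_{A\,n+\frac12}:=\frac12(\bm q_{A\,n}+\bm q_{A\,n+1})$, $\bm p^A_{n+\frac12}:=\frac12(\bm p^A_n+\bm p^A_{n+1})$, $d_{AB\,n}:=\|\bm q_{A\,n}-\bm q_{B\,n}\|$, $d_{AB\,n+1}:=\|\bm q_{A\,n+1}-\bm q_{B\,n+1}\|$, $d_{AB\,m}:=\|\bm q_{A\,n+\frac12}-\bm q_{B\,n+\frac12}\|$. Abbreviate $d=d_{AB\,n}$, $d'=d_{AB\,n+1}$, $\bm e_{AB}:=\bm q_{A\,n+\frac12}-\bm q_{B\,n+\frac12}$. The algorithmic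 forces are $$\bm f^{AB}_{\mathrm{mp}}:=\Delta t_n\hat V_{AB}'(d_{AB\,m})\frac{\bm e_{AB}}{d_{AB\,m}},\qquad \bm f^{AB}_{\mathrm{lg}}:=2\Delta t_n\frac{\hat V_{AB}(d')-\hat V_{AB}(d)}{d'-d}\,\frac{\bm e_{AB}}{d'+d},$$ $$\bm f^{AB}_{\mathrm{ge}}:=2\Delta t_n\left(\hat V_{AB\,\mathrm c}'(d')+\hat V_{AB\,\mathrm e}'(d)\right)\frac{\bm e_{AB}}{d'+d},$$ $$\bm f^{AB}_{\mathrm{pm}}:=2\Delta t_n\left(\hat V_{AB}'\left(\tfrac{d'+d}{2}\right)+\frac{(d'-d)^2}{24}\left(\hat V_{AB+}'''(d')+\hat V_{AB-}'''(d)\right)\right)\frac{\bm e_{AB}}{d'+d},$$ $$\bm f^{AB}_{\mathrm{pt}}:=2\Delta t_n\left(\frac{\hat V_{AB}'(d')+\hat V_{AB}'(d)}{2}-\frac{(d'-d)^2}{12}\left(\hat V_{AB+}'''(d)+\hat V_{AB-}'''(d')\right)\right)\frac{\bm e_{AB}}{d'+d}.$$ It is understood that all these expressions are well defined, i.e. $d_{AB\,n},d_{AB\,n+1}>0$ for all $A\ne B$, and additionally $d_{AB\,m}>0$ for the mid-point integrator and $d_{AB\,n+1}\neq d_{AB\,n}$ for the LaBudde-Greenspan integrator. *)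

(* Defs.v *)
From HB Require Import structures.
From mathcomp Require Import all_boot all_order all_algebra.
From mathcomp Require Import all_classical all_reals all_analysis.

Set Implicit Arguments.
Unset Strict Implicit.
Unset Printing Implicit Defensive.

Import Order.TTheory GRing.Theory Num.Theory.
Import numFieldNormedType.Exports.

Local Open Scope ring_scope.

Section Vectors.
Context {R : realType}.

(* The library norm `|v| on 'rV[R]_3 is the sup norm. *)
Definition enorm (v : 'rV[R]_3) : R := Num.sqrt (\sum_(k < 3) v 0 k ^+ 2).

(* Indices are added in the cyclic group 'I_3. *)
Definition crossmul (u v : 'rV[R]_3) : 'rV[R]_3 :=
  \row_(k < 3) (u 0 (k + 1) * v 0 (k + 2%:R) - u 0 (k + 2%:R) * v 0 (k + 1)).

Definition midpoint (u v : 'rV[R]_3) : 'rV[R]_3 := 2^-1 *: (u + v).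

Definition symmetric_positive_definite N (m : 'M[R]_N) : Prop :=
  m^T = m /\ forall x : 'rV[R]_N, x != 0 -> 0 < (x *m m *m x^T) 0 0.

End Vectors.

Section Potentials.
Context {R : realType}.

(* Functions on (0, oo) are encoded as total functions on R; every condition
   and every evaluation below concerns positive arguments only. *)
Definition times_differentiable (n : nat) (f : R -> R) : Prop :=
  forall (k : nat) (x : R), (k < n)%N -> 0 < x -> derivable (derive1n k f) x 1.

Record potentials (N : nat) := Potentials {
  pot : 'I_N -> 'I_N -> R -> R;
  pot_c : 'I_N -> 'I_N -> R -> R;
  pot_e : 'I_N -> 'I_N -> R -> R;
  pot_p : 'I_N -> 'I_N -> R -> R;
  pot_m : 'I_N -> 'I_N -> R -> R
}.

Definition symmetric_pair N (W : 'I_N -> 'I_N -> R -> R) : Prop :=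
  forall (A B : 'I_N) (r : R), A != B -> 0 < r -> W A B r = W B A r.

Definition convex_concave_split N (V : potentials N) : Prop :=
  [/\ symmetric_pair (pot_c V), symmetric_pair (pot_e V) &
    forall A B : 'I_N, A != B ->
      [/\ times_differentiable 2 (pot_c V A B),
          times_differentiable 2 (pot_e V A B) &
          forall r : R, 0 < r ->
            [/\ pot V A B r = pot_c V A B r + pot_e V A B r,
                0 <= derive1n 2 (pot_c V A B) r & derive1n 2 (pot_e V A B) r <= 0]]].

Definition fourth_derivative_split N (V : potentials N) : Prop :=
  [/\ symmetric_pair (pot_p V), symmetric_pair (pot_m V) &
    forall A B : 'I_N, A != B ->
      [/\ times_differentiable 4 (pot_p V A B),
          times_differentiable 4 (pot_m V A B) &
          forall r : R, 0 < r ->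
            [/\ pot V A B r = pot_p V A B r + pot_m V A B r,
                0 <= derive1n 4 (pot_p V A B) r & derive1n 4 (pot_m V A B) r <= 0]]].

Definition admissible N (V : potentials N) : Prop :=
  [/\ symmetric_pair (pot V), convex_concave_split V
    & fourth_derivative_split V].

End Potentials.

Arguments potentials : clear implicits.

Inductive integrator : Set :=
  | Midpoint
  | LaBuddeGreenspan
  | GeneralizedEyre
  | PerturbedMidpoint
  | PerturbedTrapezoidal.

Section Integrators.
Context {R : realType} {N : nat}.
Implicit Types (q p : 'I_N -> 'rV[R]_3) (A B : 'I_N).

(* Unprimed quantities are at time step n, primed ones at time step n + 1. *)

Definition dist q A B : R := enorm (q A - q B).

Definition emid q q' A B : 'rV[R]_3 :=
  midpoint (q A) (q' A) - midpoint (q B) (q' B).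

Definition dmid q q' A B : R := enorm (emid q q' A B).

Definition force (s : integrator) (V : potentials R N) (dt : R) q q' A B :
    'rV[R]_3 :=
  let d := dist q A B in
  let d' := dist q' A B in
  let dm := dmid q q' A B in
  let e := emid q q' A B in
  match s with
  | Midpoint =>
      (dt * derive1 (pot V A B) dm) *: (dm^-1 *: e)
  | LaBuddeGreenspan =>
      (2 * dt * ((pot V A B d' - pot V A B d) / (d' - d)))
        *: ((d' + d)^-1 *: e)
  | GeneralizedEyre =>
      (2 * dt * (derive1 (pot_c V A B) d' + derive1 (pot_e V A B) d))
        *: ((d' + d)^-1 *: e)
  | PerturbedMidpoint =>
      (2 * dt * (derive1 (pot V A B) ((d' + d) / 2)
                 + (d' - d) ^+ 2 / 24
                   * (derive1n 3 (pot_p V A B) d' + derive1n 3 (pot_m V A B) d)))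
        *: ((d' + d)^-1 *: e)
  | PerturbedTrapezoidal =>
      (2 * dt * ((derive1 (pot V A B) d' + derive1 (pot V A B) d) / 2
                 - (d' - d) ^+ 2 / 12
                   * (derive1n 3 (pot_p V A B) d + derive1n 3 (pot_m V A B) d')))
        *: ((d' + d)^-1 *: e)
  end.

Definition well_defined (s : integrator) q q' : Prop :=
  forall A B, A != B ->
    [/\ 0 < dist q A B, 0 < dist q' A B,
        s = Midpoint -> 0 < dmid q q' A B
      & s = LaBuddeGreenspan -> dist q' A B != dist q A B].

Definition step (s : integrator) (V : potentials R N) (m : 'M[R]_N) (dt : R)
    q p q' p' : Prop :=
  forall A,
    q' A - q A = dt *: \sum_(B < N) invmx m A B *: midpoint (p B) (p' B) /\
    p' A - p A = - \sum_(B < N | B != A) force s V dt q q' A B.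

Definition angular_momentum q p : 'rV[R]_3 :=
  \sum_(A < N) crossmul (q A) (p A).

End Integrators.

(* Main.v *)
Require Import Defs.
From HB Require Import structures.
From mathcomp Require Import all_boot all_order all_algebra.
From mathcomp Require Import all_classical all_reals all_analysis.
From mathcomp Require Import ring lra.
Import Order.TTheory GRing.Theory Num.Theory.
Local Open Scope ring_scope.

(** By the discrete product rule, [J(q', p') - J(q, p)] is the sum over [A] of
    [(q'_A - q_A) x p_mid^A + q_mid_A x (p'^A - p^A)]. The first part is a
    double sum of [m^-1_AB p_mid^B x p_mid^A], antisymmetric in [A, B] because
    [m^-1] is symmetric; the second is the total torque of forces that obey
    Newton's third law and are parallel to [q_mid_A - q_mid_B], again an
    antisymmetric double sum. The third law rests on the pair potentials being
    symmetric near every positive distance, so that their derivatives are. *)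

Section CrossProduct.
Context {R : realType}.
Implicit Types (u v : 'rV[R]_3) (c : R).

Lemma crossmulC u v : crossmul u v = - crossmul v u.
Proof. by apply/rowP => k; rewrite !mxE; ring. Qed.

Lemma crossmul_is_linear u : linear (crossmul u).
Proof. by move=> c v w; apply/rowP => k; rewrite !mxE; ring. Qed.

HB.instance Definition _ u :=
  GRing.isLinear.Build R 'rV[R]_3 'rV[R]_3 _ (crossmul u)
    (crossmul_is_linear u).

Lemma crossmulBl u v w : crossmul (u - v) w = crossmul u w - crossmul v w.
Proof. by apply/rowP => k; rewrite !mxE; ring. Qed.

Lemma crossmulvv u : crossmul u u = 0.
Proof. by apply/rowP => k; rewrite !mxE mulrC subrr. Qed.

(** Exact, with no remainder: averaging at the midpoint makes the mixed terms cancel by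
    bilinearity. *)
Lemma crossmul_discrete_product_rule u u' v v' :
  crossmul u' v' - crossmul u v =
  crossmul (u' - u) (midpoint v v') + crossmul (midpoint u u') (v' - v).
Proof. by apply/rowP => k; rewrite !mxE; field. Qed.

(** Exchanging the two indices turns the sum into its own negative; a diagonal term allowed by [P]
    vanishes for the same reason. *)
Lemma sum_antisymmetric N (P : rel 'I_N) (G : 'I_N -> 'I_N -> 'rV[R]_3) :
  symmetric P -> (forall A B, P A B -> G B A = - G A B) ->
  \sum_(A < N) \sum_(B < N | P A B) G A B = 0.
Proof.
move=> Psym Ganti; set S := LHS.
have SN : S = - S.
  rewrite {1}/S (exchange_big_dep xpredT) //= /S -sumrN; apply: eq_bigr => B _.
  rewrite -sumrN; apply: eq_big => [A|A PAB]; first exact: Psym.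
  by rewrite -Ganti // Psym.
(* [S = - S] forces [S = 0] coordinate by coordinate, in the real field. *)
apply/rowP => k; have := congr1 (fun v : 'rV[R]_3 => v 0 k) SN.
by rewrite /= !mxE; lra.
Qed.

(** Parallelism lets [x B] replace [x A] in the torque of [F A B], so the third law makes the
    torques cancel in pairs. *)
Lemma sum_torques_eq0 N (x : 'I_N -> 'rV[R]_3)
    (F : 'I_N -> 'I_N -> 'rV[R]_3) :
  (forall A B, B != A -> F B A = - F A B) ->
  (forall A B, B != A -> crossmul (x A - x B) (F A B) = 0) ->
  \sum_(A < N) crossmul (x A) (\sum_(B < N | B != A) F A B) = 0.
Proof.
move=> Fanti Fpar.
under eq_bigr do rewrite linear_sum.
apply: (@sum_antisymmetric N (fun A B => B != A)) => [A B|A B BA].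
  by rewrite eq_sym.
rewrite Fanti // linearN; congr (- _); apply/esym/eqP.
by rewrite -subr_eq0 -crossmulBl Fpar.
Qed.

Lemma sum_crossmul_symmetric N (W : 'M[R]_N) (x : 'I_N -> 'rV[R]_3) :
  W^T = W -> \sum_(A < N) crossmul (\sum_(B < N) W A B *: x B) (x A) = 0.
Proof.
move=> Wsym.
under eq_bigr do rewrite crossmulC linear_sum -sumrN.
apply: (@sum_antisymmetric N (fun _ _ => true)) => // A B _.
by rewrite opprK !linearZ /= -[in W B A]Wsym mxE -crossmulC.
Qed.

End CrossProduct.

Section Potentials.
Context {R : realType}.

(** A derivative depends only on the germ at [r], and the positive reals are a neighbourhood of [r].
    The induction keeps [r] general because it needs equality near the point. *)
Lemma derive1n_eq_pos (f g : R -> R) (n : nat) (r : R) :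
  (forall x, 0 < x -> f x = g x) -> 0 < r -> derive1n n f r = derive1n n g r.
Proof.
move=> fg; elim: n r => [|n IHn] r r_gt0; first exact: fg.
rewrite !derive1nS !derive1E; apply: near_eq_derive.
by apply: filterS (lt_nbhsr r_gt0) => x; exact: IHn.
Qed.

Lemma symmetric_pair_derive1n N (W : 'I_N -> 'I_N -> R -> R) n A B r :
  symmetric_pair W -> A != B -> 0 < r ->
  derive1n n (W A B) r = derive1n n (W B A) r.
Proof. by move=> Wsym AB; apply: derive1n_eq_pos => x; exact: Wsym. Qed.

End Potentials.

Section Forces.
Context {R : realType} {N : nat}.
Implicit Types (q : 'I_N -> 'rV[R]_3) (A B : 'I_N).

Lemma enormN (v : 'rV[R]_3) : enorm (- v) = enorm v.
Proof. by rewrite /enorm; under eq_bigr do rewrite mxE sqrrN. Qed.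

Lemma distC q A B : dist q A B = dist q B A.
Proof. by rewrite /dist -opprB enormN. Qed.

Lemma emidN q q' A B : emid q q' B A = - emid q q' A B.
Proof. by rewrite /emid opprB. Qed.

Lemma dmidC q q' A B : dmid q q' A B = dmid q q' B A.
Proof. by rewrite /dmid emidN enormN. Qed.

Lemma crossmul_emid_force s (V : potentials R N) dt q q' A B :
  crossmul (emid q q' A B) (force s V dt q q' A B) = 0.
Proof. by case: s; rewrite /force !linearZ /= crossmulvv !scaler0. Qed.

(** Swapping the particles reverses [emid] and preserves the distances, so only the scalar
    coefficients have to agree. *)
Lemma force_antisymmetric s (V : potentials R N) dt q q' A B :
  admissible V -> well_defined s q q' -> A != B ->
  force s V dt q q' B A = - force s V dt q q' A B.
Proof.
move=> [symV [symc syme _] [symp symm _]] wd AB.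
have [d_gt0 d'_gt0 dm_gt0 _] := wd A B AB.
have D (W : 'I_N -> 'I_N -> R -> R) n r : symmetric_pair W -> 0 < r ->
    derive1n n (W B A) r = derive1n n (W A B) r.
  by move=> Wsym; apply: symmetric_pair_derive1n => //; rewrite eq_sym.
have D1 (W : 'I_N -> 'I_N -> R -> R) r : symmetric_pair W -> 0 < r ->
    derive1 (W B A) r = derive1 (W A B) r.
  by rewrite -!derive1n1; exact: D.
(* The argument at which the perturbed mid-point force evaluates the first derivative. *)
have dd_gt0 : 0 < (dist q' A B + dist q A B) / 2 by lra.
have scaleN (a a' b : R) (e : 'rV[R]_3) :
    a = a' -> a *: (b *: - e) = - (a' *: (b *: e)).
  by move=> ->; rewrite !scalerN.
case: s wd dm_gt0 => wd dm_gt0; rewrite /force ?(distC q B A) ?(distC q' B A)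
  ?(dmidC q q' B A) emidN; apply: scaleN.
- by rewrite D1 // dm_gt0.
- by rewrite !(symV A B).
- by rewrite !D1.
- by rewrite (D1 _ _ symV dd_gt0) (D _ 3 _ symp d'_gt0) (D _ 3 _ symm d_gt0).
- by rewrite (D1 _ _ symV d'_gt0) (D1 _ _ symV d_gt0)
    (D _ 3 _ symp d_gt0) (D _ 3 _ symm d'_gt0).
Qed.

End Forces.

Theorem proposition7 (R : realType) (N : nat) (m : 'M[R]_N) (dt : R)
    (V : potentials R N) (s : integrator)
    (q p q' p' : 'I_N -> 'rV[R]_3)
    (m_spd : symmetric_positive_definite m)
    (dt_gt0 : 0 < dt)
    (V_adm : admissible V)
    (wd : well_defined s q q')
    (step_eq : step s V m dt q p q' p') :
  angular_momentum q' p' = angular_momentum q p.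
Proof.
apply/eqP; rewrite -subr_eq0 /angular_momentum -sumrB.
have [m_sym _] := m_spd.
(* The product rule with the step equations inserted. The velocity term is flipped, at the cost of a
   sign, since [crossmul] is declared linear in its second argument, where [dt] can be pulled
   out. *)
rewrite (eq_bigr (fun A : 'I_N =>
    dt *: - crossmul (midpoint (p A) (p' A))
            (\sum_(B < N) invmx m A B *: midpoint (p B) (p' B))
    - crossmul (midpoint (q A) (q' A))
        (\sum_(B < N | B != A) force s V dt q q' A B))); last first.
  move=> A _; have [qA pA] := step_eq A.
  rewrite crossmul_discrete_product_rule qA pA linearN.
  by rewrite crossmulC linearZ /= scalerN.
rewrite sumrB -scaler_sumr.
under [X in dt *: X]eq_bigr do rewrite -crossmulC.
(* The kinetic part vanishes because the inverse of a symmetric mass matrix is symmetric; only the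
   torques remain. *)
rewrite sum_crossmul_symmetric ?scaler0 ?sub0r ?oppr_eq0; last first.
  by rewrite trmx_inv m_sym.
apply/eqP; apply: sum_torques_eq0 => A B BA.
  by apply: force_antisymmetric => //; rewrite eq_sym.
exact: crossmul_emid_force.
Qed.
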